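(* Let $q\in\mathbb{C}\setminus\{0\}$ be not a root of unity, let $\mathcal{A}_q=\mathcal{A}_q(x,\xi,\theta,z)$ be the algebra of polynomials on the double-graded quantum superplane with the differential calculus described in the context, and let $\partial_x,\partial_\xi,\partial_\theta,\partial_z:\mathcal{A}_q\to\mathcal{A}_q$ be the partial derivatives. The commutation rules between the partial derivatives and the coordinates (as operators on $\mathcal{A}_q$, coordinates acting by left multiplication) are: $$\partial_x x=1+x\partial_x,\quad \partial_\xi x=q\,x\partial_\xi,\quad \partial_\theta x=q\,x\partial_\theta,\quad \partial_z x=x\partial_z,$$ $$\partial_x\xi=q^{-1}\xi\partial_x,\quad \partial_\xi\xi=1-\xi\partial_\xi,\quad \partial_\theta\xi=\xi\partial_\theta,\quad \partial_z\xi=-q^{-1}\xi\partial_z,$$ $$\partial_x\theta=q^{-1}\theta\partial_x,\quad \partial_\xi\theta=\theta\partial_\xi,\quad \partial_\theta\theta=1-\theta\partial_\theta,\quad \partial_z\theta=-q^{-1}\theta\partial_z,$$ $$\partial_x z=z\partial_x,\quad \partial_\xi z=-q\,z\partial_\xi,\quad \partial_\theta z=-q\,z\partial_\theta,\quad \partial_z z=1+z\partial_z.$$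
   Context: The base field is $\mathbb{C}$. $\mathcal{A}_q=\mathcal{A}_q(x,\xi,\theta,z)$ is the $\mathbb{Z}_2\times\mathbb{Z}_2$-graded, associative, unital algebra generated by $x,\xi,\theta,z$ of degrees $(0,0),(0,1),(1,0),(1,1)$ respectively, subject to the relations $$x\xi=q\,\xi x,\quad x\theta=q\,\theta x,\quad xz=zx,\quad \xi^2=0,\quad \theta^2=0,\quad \xi\theta=\theta\xi,\quad \xi z=-q^{-1}z\xi,\quad \theta z=-q^{-1}z\theta.$$ The differential calculus: $\mathrm{d}:\mathcal{A}_q\to\Omega^1(\mathcal{A}_q)$ is a linear map into an $\mathcal{A}_q$-bimodule satisfying the Leibniz rule $\mathrm{d}(fg)=(\mathrm{d}f)g+f\,\mathrm{d}g$; the one-forms $\mathrm{d}x,\mathrm{d}\xi,\mathrm{d}\theta,\mathrm{d}z$ form a basis of $\Omega^1(\mathcal{A}_q)$ (as a right $\mathcal{A}_q$-module), and the following commutation rules hold: $$x\,\mathrm{d}x=\mathrm{d}x\,x,\quad x\,\mathrm{d}\xi=q\,\mathrm{d}\xi\,x,\quad x\,\mathrm{d}\theta=q\,\mathrm{d}\theta\,x,\quad x\,\mathrm{d}z=\mathrm{d}z\,x,$$ $$\xi\,\mathrm{d}x=q^{-1}\mathrm{d}x\,\xi,\quad \xi\,\mathrm{d}\xi=-\mathrm{d}\xi\,\xi,\quad \xi\,\mathrm{d}\theta=\mathrm{d}\theta\,\xi,\quad \xi\,\mathrm{d}z=-q^{-1}\mathrm{d}z\,\xi,$$ $$\theta\,\mathrm{d}x=q^{-1}\mathrm{d}x\,\theta,\quad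 \theta\,\mathrm{d}\xi=\mathrm{d}\xi\,\theta,\quad \theta\,\mathrm{d}\theta=-\mathrm{d}\theta\,\theta,\quad \theta\,\mathrm{d}z=-q^{-1}\mathrm{d}z\,\theta,$$ $$z\,\mathrm{d}x=\mathrm{d}x\,z,\quad z\,\mathrm{d}\xi=-q\,\mathrm{d}\xi\,z,\quad z\,\mathrm{d}\theta=-q\,\mathrm{d}\theta\,z,\quad z\,\mathrm{d}z=\mathrm{d}z\,z.$$ The partial derivatives are the linear maps $\partial_x,\partial_\xi,\partial_\theta,\partial_z:\mathcal{A}_q\to\mathcal{A}_q$ defined by $\mathrm{d}f=\mathrm{d}x\,\partial_xf+\mathrm{d}\xi\,\partial_\xi f+\mathrm{d}\theta\,\partial_\theta f+\mathrm{d}z\,\partial_zf$ for all $f\in\mathcal{A}_q$. *)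

(* Defs.v *)
From HB Require Import structures.
From mathcomp Require Import all_boot all_order all_algebra.
From mathcomp Require Import finmap monalg boolp.

Set Implicit Arguments.
Unset Strict Implicit.
Unset Printing Implicit Defensive.

Import GRing.Theory.
Local Open Scope ring_scope.
Local Open Scope quotient_scope.

(* Each of the four generators x, xi, theta, z is indexed by its own degree   *)
(* in Z_2 x Z_2, so that the degree of a word is the sum of its letters.      *)
Notation Z22 := ('Z_2 * 'Z_2)%type.
Notation free_alg K := {malg K[{fmonom Z22}]}.

Definition free_gen (K : fieldType) (i : Z22) : free_alg K := << fmu i >>.

Definition ix : Z22 := (0, 0).
Definition ixi : Z22 := (0, 1).
Definition itheta : Z22 := (1, 0).
Definition iz : Z22 := (1, 1).

Definition word_deg (w : {fmonom Z22}) : Z22 := \sum_(i <- fmonom_val w) i.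

Lemma malg_scaleAr (K : comNzRingType) (W : monomType) (c : K)
  (u v : {malg K[W]}) : c *: (u * v) = u * (c *: v).
Proof.
apply/malgP=> w.
rewrite mcoeffZ (mcoeffMlw w (fsubset_refl (msupp u)) (msuppZ_le c v)).
rewrite mcoeffMl mulr_sumr; apply: eq_bigr => w1 _.
rewrite mulr_sumr; apply: eq_bigr => w2 _.
by rewrite mcoeffZ mulrnAr mulrCA.
Qed.

Lemma sum_mul_sum (A : nzRingType) (T : Type) (s t : seq T) (F G : T -> A) r :
  (\sum_(i <- s) F i) * r * (\sum_(j <- t) G j) =
  \sum_(i <- s) \sum_(j <- t) F i * r * G j.
Proof.
by rewrite !mulr_suml; apply: eq_bigr => i _; rewrite mulr_sumr.
Qed.

Section Superplane.
Variables (K : fieldType) (q : K).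

Definition relators : seq (free_alg K) :=
  let x := free_gen K ix in let xi := free_gen K ixi in
  let theta := free_gen K itheta in let z := free_gen K iz in
  [:: x * xi - q *: (xi * x);
      x * theta - q *: (theta * x);
      x * z - z * x;
      xi * xi;
      theta * theta;
      xi * theta - theta * xi;
      xi * z + q^-1 *: (z * xi);
      theta * z + q^-1 *: (z * theta)].

(* The two-sided ideal generated by the relators: finite sums of a * r * b.   *)
Inductive in_ideal : free_alg K -> Prop :=
| in_ideal0 : in_ideal 0
| in_idealD u v : in_ideal u -> in_ideal v -> in_ideal (u + v)
| in_ideal_gen a r b : r \in relators -> in_ideal (a * r * b).

Lemma in_idealN u : in_ideal u -> in_ideal (- u).
Proof.
elim=> [|{}u v _ Iu _ Iv|a r b r_rel]; first by rewrite oppr0; constructor.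
- by rewrite opprD; constructor.
- by rewrite -!mulNr; constructor.
Qed.

Lemma in_idealMl a u : in_ideal u -> in_ideal (a * u).
Proof.
elim=> [|{}u v _ Iu _ Iv|b r c r_rel]; first by rewrite mulr0; constructor.
- by rewrite mulrDr; constructor.
- by rewrite !mulrA; constructor.
Qed.

Lemma in_idealMr a u : in_ideal u -> in_ideal (u * a).
Proof.
elim=> [|{}u v _ Iu _ Iv|b r c r_rel]; first by rewrite mul0r; constructor.
- by rewrite mulrDl; constructor.
- by rewrite -mulrA; constructor.
Qed.

Definition ideal : {pred free_alg K} := fun u => `[< in_ideal u >].

Lemma idealP u : reflect (in_ideal u) (u \in ideal).
Proof. exact: asboolP. Qed.

Lemma ideal_zmod_closed : zmod_closed ideal.
Proof.
split=> [|u v /idealP Iu /idealP Iv]; apply/idealP; first exact: in_ideal0.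
by apply: in_idealD => //; apply: in_idealN.
Qed.

HB.instance Definition _ := GRing.isZmodClosed.Build _ ideal ideal_zmod_closed.

(* The type is kept for all q : K; at q = 0 the convention 0^-1 = 0 applies.  *)
Definition superplane := Quotient.quot ideal.
HB.instance Definition _ := GRing.Zmodule.on superplane.
HB.instance Definition _ := EqQuotient.on superplane.

Definition spi (u : free_alg K) : superplane := \pi_superplane u.

Lemma spi_eq u v : (spi u = spi v) <-> in_ideal (u - v).
Proof.
split=> [/eqP|/idealP]; last first.
  by rewrite Quotient.idealrBE => /eqP.
by move=> h; apply/idealP; rewrite Quotient.idealrBE.
Qed.

Lemma spiK f : spi (repr f) = f. Proof. exact: reprK. Qed.

Lemma spiD u v : spi (u + v) = spi u + spi v.
Proof. by rewrite /spi !piE. Qed.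

Lemma spi0 : spi 0 = 0.
Proof. by rewrite /spi !piE. Qed.

Definition sp_one : superplane := spi 1.
Definition sp_mul (f g : superplane) : superplane := spi (repr f * repr g).
Definition sp_scale (c : K) (f : superplane) : superplane := spi (c *: repr f).

Lemma in_ideal_repr u : in_ideal (repr (spi u) - u).
Proof. by apply/spi_eq; rewrite spiK. Qed.

Lemma spiM u v : spi (u * v) = sp_mul (spi u) (spi v).
Proof.
apply/esym/spi_eq.
move: (in_ideal_repr u) (in_ideal_repr v).
move: (repr (spi u)) (repr (spi v)) => u' v' Iu Iv.
have -> : u' * v' - u * v = (u' - u) * v' + u * (v' - v).
  by rewrite mulrBl mulrBr addrA subrK.
by apply: in_idealD; [apply: in_idealMr | apply: in_idealMl].
Qed.

Lemma spiZ c u : spi (c *: u) = sp_scale c (spi u).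
Proof.
apply/esym/spi_eq; rewrite -scalerBr -mul_malgC.
exact/in_idealMl/in_ideal_repr.
Qed.

Lemma spW (P : superplane -> Prop) : (forall u, P (spi u)) -> forall f, P f.
Proof. by move=> Pspi f; rewrite -[f]spiK. Qed.

Lemma sp_mulA : associative sp_mul.
Proof. by do 3![elim/spW=> ?]; rewrite -!spiM mulrA. Qed.
Lemma sp_mul1l : left_id sp_one sp_mul.
Proof. by elim/spW=> ?; rewrite -!spiM mul1r. Qed.
Lemma sp_mul1r : right_id sp_one sp_mul.
Proof. by elim/spW=> ?; rewrite -!spiM mulr1. Qed.
Lemma sp_mulDl : left_distributive sp_mul +%R.
Proof. by do 3![elim/spW=> ?]; rewrite -!(spiM, spiD) mulrDl. Qed.
Lemma sp_mulDr : right_distributive sp_mul +%R.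
Proof. by do 3![elim/spW=> ?]; rewrite -!(spiM, spiD) mulrDr. Qed.

Lemma in_ideal_const u : in_ideal u -> u@_mone = 0.
Proof.
move=> Iu; elim: u / Iu => [|u v _ u0 _ v0|a r b r_rel]; rewrite ?mcoeff0 //.
  by rewrite mcoeffD u0 v0 addr0.
have gen0 i : (free_gen K i)@_mone = 0.
  by rewrite mcoeffU fm1_eq1 mulr0n.
have cM (u v : free_alg K) : (u * v)@_mone = u@_mone * v@_mone.
  exact: (rmorphM (mcoeff mone)).
have gg i j : (free_gen K i * free_gen K j)@_mone = 0.
  by rewrite cM (gen0 i) mul0r.
have cB c (u v : free_alg K) :
    u@_mone = 0 -> v@_mone = 0 -> (u - c *: v)@_mone = 0.
  by move=> u0 v0; rewrite mcoeffB mcoeffZ u0 v0 mulr0 subr0.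
have cB1 (u v : free_alg K) : u@_mone = 0 -> v@_mone = 0 -> (u - v)@_mone = 0.
  by move=> u0 v0; rewrite mcoeffB u0 v0 subr0.
have cD c (u v : free_alg K) :
    u@_mone = 0 -> v@_mone = 0 -> (u + c *: v)@_mone = 0.
  by move=> u0 v0; rewrite mcoeffD mcoeffZ u0 v0 mulr0 addr0.
suff r0 : r@_mone = 0 by rewrite !cM r0 mulr0 mul0r.
move: r_rel; rewrite !inE.
case/orP=> [/eqP->|]; first exact: cB (gg _ _) (gg _ _).
case/orP=> [/eqP->|]; first exact: cB (gg _ _) (gg _ _).
case/orP=> [/eqP->|]; first exact: cB1 (gg _ _) (gg _ _).
case/orP=> [/eqP->|]; first exact: gg.
case/orP=> [/eqP->|]; first exact: gg.
case/orP=> [/eqP->|]; first exact: cB1 (gg _ _) (gg _ _).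
by case/orP=> /eqP->; exact: cD (gg _ _) (gg _ _).
Qed.

Lemma sp_one_neq0 : sp_one != 0.
Proof.
apply/eqP; rewrite /sp_one -spi0 => /spi_eq/in_ideal_const/eqP.
by rewrite subr0 mcoeff1 eqxx oner_eq0.
Qed.

HB.instance Definition _ := GRing.Zmodule_isNzRing.Build superplane
  sp_mulA sp_mul1l sp_mul1r sp_mulDl sp_mulDr sp_one_neq0.

Lemma sp_scaleA a b f : sp_scale a (sp_scale b f) = sp_scale (a * b) f.
Proof. by elim/spW: f => ?; rewrite -!spiZ scalerA. Qed.
Lemma sp_scale1 : left_id 1 sp_scale.
Proof. by elim/spW=> ?; rewrite -spiZ scale1r. Qed.
Lemma sp_scaleDr : right_distributive sp_scale +%R.
Proof. by move=> a; do 2![elim/spW=> ?]; rewrite -!(spiD, spiZ) scalerDr. Qed.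
Lemma sp_scaleDl f : {morph sp_scale^~ f : a b / a + b}.
Proof. by elim/spW: f => ? a b; rewrite -!(spiD, spiZ) scalerDl. Qed.

HB.instance Definition _ := GRing.Zmodule_isLmodule.Build K superplane
  sp_scaleA sp_scale1 sp_scaleDr sp_scaleDl.

Lemma spi_mul u v : spi (u * v) = spi u * spi v. Proof. exact: spiM. Qed.
Lemma spi_scale c u : spi (c *: u) = c *: spi u. Proof. exact: spiZ. Qed.

Lemma sp_scaleAl (c : K) (f g : superplane) : c *: (f * g) = (c *: f) * g.
Proof.
elim/spW: f => u; elim/spW: g => v.
by rewrite -spi_mul -!spi_scale -spi_mul scalerAl.
Qed.

HB.instance Definition _ := GRing.Lmodule_isLalgebra.Build K superplane
  sp_scaleAl.

Lemma sp_scaleAr (c : K) (f g : superplane) : c *: (f * g) = f * (c *: g).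
Proof.
elim/spW: f => u; elim/spW: g => v.
by rewrite -spi_mul -!spi_scale -spi_mul malg_scaleAr.
Qed.

HB.instance Definition _ := GRing.Lalgebra_isAlgebra.Build K superplane
  sp_scaleAr.

Definition sp_gen (i : Z22) : superplane := spi (free_gen K i).
Definition sp_x := sp_gen ix.
Definition sp_xi := sp_gen ixi.
Definition sp_theta := sp_gen itheta.
Definition sp_z := sp_gen iz.

Definition free_homog (d : Z22) (u : free_alg K) : Prop :=
  forall w, u@_w != 0 -> word_deg w = d.

(* The component of degree d of the (Z_2 x Z_2)-grading.                      *)
Definition homog (d : Z22) (f : superplane) : Prop :=
  exists2 u, free_homog d u & f = spi u.

Lemma free_homog0 d : free_homog d 0.
Proof. by move=> w; rewrite mcoeff0 eqxx. Qed.

Lemma free_homogD d u v :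
  free_homog d u -> free_homog d v -> free_homog d (u + v).
Proof.
move=> du dv w; rewrite mcoeffD; have [u0|/du//] := eqVneq u@_w 0.
by rewrite u0 add0r => /dv.
Qed.

Lemma free_homogZ d c u : free_homog d u -> free_homog d (c *: u).
Proof. by move=> du w; rewrite mcoeffZ mulf_eq0 negb_or => /andP[_ /du]. Qed.

Lemma free_homogB d u v :
  free_homog d u -> free_homog d v -> free_homog d (u - v).
Proof. by move=> du dv; rewrite -scaleN1r; apply/free_homogD/free_homogZ. Qed.

Lemma word_degM w1 w2 : word_deg (mmul w1 w2) = word_deg w1 + word_deg w2.
Proof. by rewrite /word_deg fmM big_cat. Qed.

Lemma free_homogU c w : free_homog (word_deg w) << c *g w >>.
Proof.
by move=> w'; rewrite mcoeffU; case: (eqVneq w w') => [->|]; rewrite ?eqxx.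
Qed.

Lemma free_homogM d e u v :
  free_homog d u -> free_homog e v -> free_homog (d + e) (u * v).
Proof.
move=> du ev w; rewrite mcoeff_neq0 => /msuppM_le[w1 [w2 [w1u w2v ->]]].
by rewrite word_degM (du w1) ?(ev w2) // mcoeff_neq0.
Qed.

Lemma free_homog1 : free_homog 0 1.
Proof.
move=> w; rewrite mcoeff1; case: (eqVneq w mone) => [->|]; rewrite ?eqxx // => _.
by rewrite /word_deg fm1 big_nil.
Qed.

Lemma free_homog_gen i : free_homog i (free_gen K i).
Proof.
have := @free_homogU 1 (fmu i); rewrite /word_deg fmU big_seq1; exact.
Qed.

Lemma relator_homog r : r \in relators -> exists d, free_homog d r.
Proof.
have gg i j : free_homog (i + j) (free_gen K i * free_gen K j).
  by apply: free_homogM; apply: free_homog_gen.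
have gg' i j : free_homog (i + j) (free_gen K j * free_gen K i).
  by rewrite addrC; apply: gg.
rewrite !inE.
case/orP=> [/eqP->|]; first by exists (ix + ixi); apply/free_homogB/free_homogZ.
case/orP=> [/eqP->|].
  by exists (ix + itheta); apply/free_homogB/free_homogZ.
case/orP=> [/eqP->|]; first by exists (ix + iz); apply: free_homogB.
case/orP=> [/eqP->|]; first by exists (ixi + ixi).
case/orP=> [/eqP->|]; first by exists (itheta + itheta).
case/orP=> [/eqP->|]; first by exists (ixi + itheta); apply: free_homogB.
case/orP=> /eqP->; first by exists (ixi + iz); apply/free_homogD/free_homogZ.
by exists (itheta + iz); apply/free_homogD/free_homogZ.
Qed.

Definition hpart_word (d : Z22) (w : {fmonom Z22}) : free_alg K :=
  if word_deg w == d then << w >> else 0.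
Definition hpart (d : Z22) : free_alg K -> free_alg K :=
  mmap (@malgC _ K) (hpart_word d).

Lemma hpart_coef d u w : (hpart d u)@_w = if word_deg w == d then u@_w else 0.
Proof.
rewrite /hpart mmapE raddf_sum /=.
under eq_bigr => w' _.
  have -> : ((u@_w')%:MP * hpart_word d w')@_w =
      if word_deg w == d then << u@_w' *g w' >>@_w else 0.
    rewrite mcoeffCM /hpart_word mcoeffU.
    case: (eqVneq w' w) => [->|ne].
      by case: ifP => _; rewrite ?mcoeffUU ?mcoeff0 ?mulr1 ?mulr0.
    rewrite mulr0n if_same.
    by case: ifP; rewrite ?mcoeffU ?(negbTE ne) ?mcoeff0 mulr0.
  over.
case: ifP => _; last by rewrite big1.
by rewrite [in RHS](monalgE u) raddf_sum.
Qed.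

Lemma hpart_is_additive d : {morph hpart d : u v / u + v}.
Proof. by move=> u v; rewrite /hpart raddfD. Qed.

Lemma hpart_sum d (T : Type) (s : seq T) (F : T -> free_alg K) :
  hpart d (\sum_(t <- s) F t) = \sum_(t <- s) hpart d (F t).
Proof. by rewrite /hpart raddf_sum. Qed.

Lemma hpart_homog d e u :
  free_homog d u -> hpart e u = if e == d then u else 0.
Proof.
move=> du; apply/malgP=> w; rewrite hpart_coef.
have [u0|/du wd] := eqVneq u@_w 0.
  by rewrite u0 if_same; case: ifP; rewrite ?mcoeff0 ?u0.
by rewrite wd eq_sym; case: ifP; rewrite ?mcoeff0.
Qed.

Lemma in_ideal_sum (T : Type) (s : seq T) (P : pred T) (F : T -> free_alg K) :
  (forall t, in_ideal (F t)) -> in_ideal (\sum_(t <- s | P t) F t).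
Proof. by move=> IF; elim/big_ind: _ => //; constructor. Qed.

Lemma in_ideal_hpart e u : in_ideal u -> in_ideal (hpart e u).
Proof.
move=> Iu; elim: u / Iu => [|u v _ Iu _ Iv|a r b r_rel].
- by rewrite /hpart raddf0; constructor.
- by rewrite hpart_is_additive; constructor.
have [d dr] := relator_homog r_rel.
rewrite (monalgE a) (monalgE b) sum_mul_sum.
rewrite hpart_sum; apply: in_ideal_sum => w1.
rewrite hpart_sum; apply: in_ideal_sum => w2.
rewrite (@hpart_homog (word_deg w1 + d + word_deg w2)).
  by case: ifP => _; constructor.
by apply/free_homogM/free_homogU/free_homogM/dr/free_homogU.
Qed.

Lemma hpart_free_homog d u : free_homog d (hpart d u).
Proof. by move=> w; rewrite hpart_coef; case: (eqVneq (word_deg w) d); rewrite ?eqxx. Qed.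

Lemma sum_hpart u : u = \sum_d hpart d u.
Proof.
apply/malgP=> w; rewrite raddf_sum /= (bigD1 (word_deg w)) //=.
rewrite hpart_coef eqxx big1 ?addr0 // => d /negbTE.
by rewrite hpart_coef eq_sym => ->.
Qed.

Lemma spi_sum (T : Type) (s : seq T) (F : T -> free_alg K) :
  spi (\sum_(t <- s) F t) = \sum_(t <- s) spi (F t).
Proof. exact: (big_morph spi spiD spi0). Qed.

Lemma homog_gen i : homog i (sp_gen i).
Proof. by exists (free_gen K i) => //; apply: free_homog_gen. Qed.

Lemma homog1 : homog 0 1.
Proof. by exists 1 => //; apply: free_homog1. Qed.

Lemma homogM d e f g : homog d f -> homog e g -> homog (d + e) (f * g).
Proof.
move=> [u du ->] [v ev ->]; exists (u * v); last by rewrite spi_mul.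
exact: free_homogM.
Qed.

Lemma homog_linear d c f g : homog d f -> homog d g -> homog d (c *: f + g).
Proof.
move=> [u du ->] [v dv ->]; exists (c *: u + v).
  by apply: free_homogD => //; apply: free_homogZ.
by rewrite spiD spi_scale.
Qed.

Lemma homog_decomposition f :
  exists! c : {ffun Z22 -> superplane},
    (forall d, homog d (c d)) /\ f = \sum_d c d.
Proof.
exists [ffun d => spi (hpart d (repr f))]; split.
  split=> [d|].
    rewrite ffunE; exists (hpart d (repr f)) => //; exact: hpart_free_homog.
  under eq_bigr do rewrite ffunE.
  by rewrite -spi_sum -sum_hpart spiK.
move=> c [hc fE]; apply/ffunP=> d; rewrite ffunE.
have /fin_all_exists2[u uh uE] : forall e,
    exists2 u, free_homog e u & c e = spi u by [].
rewrite (uE d); apply/spi_eq.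
have -> : u d = hpart d (\sum_e u e).
  rewrite hpart_sum (bigD1 d) //= (hpart_homog d (uh d)) eqxx.
  rewrite big1 ?addr0 // => e ed.
  by rewrite (hpart_homog d (uh e)) eq_sym (negbTE ed).
rewrite /hpart -raddfB; apply: in_ideal_hpart; apply/spi_eq.
by rewrite spiK fE spi_sum; apply: eq_bigr => e _.
Qed.

End Superplane.

(* Bimodules over a K-algebra A: both actions are K-bilinear for one and the  *)
(* same K-scaling, i.e. scalars act equally from the left and from the right. *)
HB.mixin Record Lmodule_isBimodule (K : fieldType) (A : algType K) M
    of GRing.Lmodule K M := {
  lact : A -> M -> M;
  ract : M -> A -> M;
  lact_linearl : forall m, linear (lact^~ m);
  lact_linearr : forall a, linear (lact a);
  ract_linearl : forall a, linear (ract^~ a);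
  ract_linearr : forall m, linear (ract m);
  lact1 : forall m, lact 1 m = m;
  ract1 : forall m, ract m 1 = m;
  lactM : forall a b m, lact (a * b) m = lact a (lact b m);
  ractM : forall m a b, ract m (a * b) = ract (ract m a) b;
  lact_ract : forall a m b, ract (lact a m) b = lact a (ract m b)
}.

#[short(type="bimodType")]
HB.structure Definition Bimodule (K : fieldType) (A : algType K) :=
  { M of GRing.Lmodule K M & Lmodule_isBimodule K A M }.

Notation "a *> m" := (lact a m) (at level 40, left associativity) : ring_scope.
Notation "m <* a" := (ract m a) (at level 40, left associativity) : ring_scope.

(* Every m is uniquely a combination of the b i with coefficients in A acting *)
(* from the right: M is a free right A-module on b.                           *)
Definition right_basis (K : fieldType) (A : algType K) (M : bimodType A)
    (I : finType) (b : I -> M) : Prop :=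
  forall m, exists! v : {ffun I -> A}, m = \sum_i b i <* v i.

Record superplane_calculus (K : fieldType) (q : K)
    (M : bimodType (superplane q)) (d : {linear superplane q -> M}) : Prop := {
  calc_leibniz : forall f g, d (f * g) = d f <* g + f *> d g;
  calc_basis : right_basis (fun i => d (sp_gen q i));

  calc_x_dx : sp_x q *> d (sp_x q) = d (sp_x q) <* sp_x q;
  calc_x_dxi : sp_x q *> d (sp_xi q) = q *: (d (sp_xi q) <* sp_x q);
  calc_x_dtheta : sp_x q *> d (sp_theta q) = q *: (d (sp_theta q) <* sp_x q);
  calc_x_dz : sp_x q *> d (sp_z q) = d (sp_z q) <* sp_x q;

  calc_xi_dx : sp_xi q *> d (sp_x q) = q^-1 *: (d (sp_x q) <* sp_xi q);
  calc_xi_dxi : sp_xi q *> d (sp_xi q) = - (d (sp_xi q) <* sp_xi q);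
  calc_xi_dtheta : sp_xi q *> d (sp_theta q) = d (sp_theta q) <* sp_xi q;
  calc_xi_dz : sp_xi q *> d (sp_z q) = - q^-1 *: (d (sp_z q) <* sp_xi q);

  calc_theta_dx : sp_theta q *> d (sp_x q) = q^-1 *: (d (sp_x q) <* sp_theta q);
  calc_theta_dxi : sp_theta q *> d (sp_xi q) = d (sp_xi q) <* sp_theta q;
  calc_theta_dtheta :
    sp_theta q *> d (sp_theta q) = - (d (sp_theta q) <* sp_theta q);
  calc_theta_dz :
    sp_theta q *> d (sp_z q) = - q^-1 *: (d (sp_z q) <* sp_theta q);

  calc_z_dx : sp_z q *> d (sp_x q) = d (sp_x q) <* sp_z q;
  calc_z_dxi : sp_z q *> d (sp_xi q) = - q *: (d (sp_xi q) <* sp_z q);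
  calc_z_dtheta : sp_z q *> d (sp_theta q) = - q *: (d (sp_theta q) <* sp_z q);
  calc_z_dz : sp_z q *> d (sp_z q) = d (sp_z q) <* sp_z q
}.

(* Main.v *)
Require Import Defs.
From mathcomp Require Import all_boot all_order all_algebra.
From mathcomp Require Import reals complex.

(* Apply the Leibniz rule to d(g f) for a generator g, expand d f in the basis
   of one-forms, and move g to the right past each d(g_j): both sides are then
   right combinations of the one-forms, whose coefficients must agree.        *)

Set Implicit Arguments.
Unset Strict Implicit.
Unset Printing Implicit Defensive.

Import GRing.Theory.
Local Open Scope ring_scope.

Lemma forall_Z22 (P : Z22 -> Prop) :
  P ix -> P ixi -> P itheta -> P iz -> forall i, P i.
Proof.
(* Values from 2 on contradict the ordinal bound. The four remaining pairs can differ from the named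
   indices only in the proofs of their bounds, which [val_inj] ignores. *)
move=> P00 P01 P10 P11 [[[|[|//]] a] [[|[|//]] b]].
- by have -> : (Ordinal a, Ordinal b) = ix by congr (_, _); apply: val_inj.
- by have -> : (Ordinal a, Ordinal b) = ixi by congr (_, _); apply: val_inj.
- by have -> : (Ordinal a, Ordinal b) = itheta by congr (_, _); apply: val_inj.
- by have -> : (Ordinal a, Ordinal b) = iz by congr (_, _); apply: val_inj.
Qed.

Lemma big_Z22 (V : nmodType) (F : Z22 -> V) :
  \sum_i F i = F ix + F ixi + F itheta + F iz.
Proof.
rewrite (bigD1 ix) // (bigD1 ixi) // (bigD1 itheta) // (bigD1 iz) //=.
(* The leftover sum excludes all four indices, so its range is empty. *)
by rewrite big1 ?addr0 ?addrA //; apply: forall_Z22.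
Qed.

Section Bimodule.
Variables (K : fieldType) (A : algType K) (M : bimodType A).

Lemma ractDr (m : M) (a b : A) : m <* (a + b) = m <* a + m <* b.
Proof. by have /(_ 1 a b) := ract_linearr m; rewrite !scale1r. Qed.

Lemma ract0 (m : M) : m <* (0 : A) = 0.
Proof. by apply: (addIr (m <* (0 : A))); rewrite -ractDr !add0r. Qed.

Lemma ractZr (m : M) (c : K) (a : A) : m <* (c *: a) = c *: (m <* a).
Proof. by have /(_ c a 0) := ract_linearr m; rewrite ract0 !addr0. Qed.

Lemma ractDl (m n : M) (a : A) : (m + n) <* a = m <* a + n <* a.
Proof. by have /(_ M 1 m n) := ract_linearl a; rewrite !scale1r. Qed.

Lemma ract0l (a : A) : (0 : M) <* a = 0.
Proof. by apply: (addIr ((0 : M) <* a)); rewrite -ractDl !add0r. Qed.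

Lemma ractZl (m : M) (c : K) (a : A) : (c *: m) <* a = c *: (m <* a).
Proof. by have /(_ M c m 0) := ract_linearl a; rewrite ract0l !addr0. Qed.

Lemma lactDr (a : A) (m n : M) : a *> (m + n) = a *> m + a *> n.
Proof. by have /(_ M 1 m n) := lact_linearr a; rewrite !scale1r. Qed.

Lemma lact0 (a : A) : a *> (0 : M) = 0.
Proof. by apply: (addIr (a *> (0 : M))); rewrite -lactDr !add0r. Qed.

Lemma lact_sum (I : finType) (a : A) (F : I -> M) :
  a *> (\sum_i F i) = \sum_i a *> F i.
Proof. exact: (big_morph _ (lactDr a) (lact0 a)). Qed.

(** Comparison of coefficients, from the uniqueness half of freeness: packed as finite functions,
    both families equal the unique coordinate vector [w]. *)
Lemma right_basis_inj (I : finType) (b : I -> M) (u v : I -> A) :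
  right_basis b -> \sum_i b i <* u i = \sum_i b i <* v i -> u =1 v.
Proof.
move=> /(_ (\sum_i b i <* u i))[w [_ w_uniq]] uv i.
have wu : w = [ffun i => u i].
  by apply: w_uniq; apply: eq_bigr => j _; rewrite ffunE.
have wv : w = [ffun i => v i].
  by apply: w_uniq; rewrite uv; apply: eq_bigr => j _; rewrite ffunE.
by have := congr1 (fun h : {ffun I -> A} => h i) wu; rewrite wv !ffunE.
Qed.

End Bimodule.

(** Treats the four rules of one generator together: [c j] is the factor picked up when generator
    [i] passes the one-form of index [j], and the [if] is a Kronecker delta coming from the
    differential of generator [i] itself. *)
Lemma partial_gen_mul (K : fieldType) (q : K) (M : bimodType (superplane q))
    (d : {linear superplane q -> M}) (p : Z22 -> superplane q -> superplane q)
    (i : Z22) (c : Z22 -> K) :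
  superplane_calculus d ->
  (forall f, d f = \sum_j d (sp_gen q j) <* p j f) ->
  (forall j, sp_gen q i *> d (sp_gen q j) =
             c j *: (d (sp_gen q j) <* sp_gen q i)) ->
  forall f j, p j (sp_gen q i * f) =
    (if j == i then f else 0) + c j *: (sp_gen q i * p j f).
Proof.
move=> calc pE gd f; apply: right_basis_inj (calc_basis calc) _.
rewrite -pE (calc_leibniz calc) [d f]pE lact_sum.
under [RHS]eq_bigr do rewrite ractDr.
rewrite big_split /=; congr (_ + _).
  by rewrite (bigD1 i) //= eqxx big1 ?addr0 // => j /negbTE->; rewrite ract0.
(* Compatibility of the two actions lets the generator meet the one-form first; after the exchange,
   [ractM] joins it to [p j f]. *)
by apply: eq_bigr => j _; rewrite -lact_ract gd ractZl ractZr ractM.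
Qed.

Theorem theorem4 (R : realType) (q : R[i]) (q_neq0 : q != 0)
  (q_not_root_of_unity : forall n : nat, (0 < n)%N -> ~~ n.-unity_root q)
  (Omega : bimodType (superplane q)) (d : {linear superplane q -> Omega})
  (calculus : superplane_calculus d)
  (partial_x partial_xi partial_theta partial_z : {linear superplane q -> superplane q})
  (partialE : forall f : superplane q,
     d f = d (sp_x q) <* partial_x f + d (sp_xi q) <* partial_xi f
         + d (sp_theta q) <* partial_theta f + d (sp_z q) <* partial_z f) :
  let x := sp_x q in let xi := sp_xi q in
  let theta := sp_theta q in let z := sp_z q in
  forall f : superplane q,
  [/\ [/\ partial_x (x * f) = f + x * partial_x f,
          partial_xi (x * f) = q *: (x * partial_xi f),
          partial_theta (x * f) = q *: (x * partial_theta f) &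
          partial_z (x * f) = x * partial_z f],
      [/\ partial_x (xi * f) = q^-1 *: (xi * partial_x f),
          partial_xi (xi * f) = f - xi * partial_xi f,
          partial_theta (xi * f) = xi * partial_theta f &
          partial_z (xi * f) = - q^-1 *: (xi * partial_z f)],
      [/\ partial_x (theta * f) = q^-1 *: (theta * partial_x f),
          partial_xi (theta * f) = theta * partial_xi f,
          partial_theta (theta * f) = f - theta * partial_theta f &
          partial_z (theta * f) = - q^-1 *: (theta * partial_z f)] &
      [/\ partial_x (z * f) = z * partial_x f,
          partial_xi (z * f) = - q *: (z * partial_xi f),
          partial_theta (z * f) = - q *: (z * partial_theta f) &
          partial_z (z * f) = f + z * partial_z f]].
Proof.
move=> x xi theta z f.
(* Turns four values, listed in the order x, xi, theta, z, into a function of the index, with [iz]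
   as the default case. It serves both for the partial derivatives and for the scalars. *)
pose sel (T : Type) (a b c e : T) (i : Z22) : T :=
  if i == ix then a else if i == ixi then b else if i == itheta then c else e.
pose p := sel _ (partial_x : _ -> _) (partial_xi : _ -> _)
                (partial_theta : _ -> _) (partial_z : _ -> _).
have pE g : d g = \sum_j d (sp_gen q j) <* p j g.
  by rewrite partialE big_Z22.
have comm i a b c e :
    sp_gen q i *> d (sp_x q) = a *: (d (sp_x q) <* sp_gen q i) ->
    sp_gen q i *> d (sp_xi q) = b *: (d (sp_xi q) <* sp_gen q i) ->
    sp_gen q i *> d (sp_theta q) = c *: (d (sp_theta q) <* sp_gen q i) ->
    sp_gen q i *> d (sp_z q) = e *: (d (sp_z q) <* sp_gen q i) ->
    forall j, p j (sp_gen q i * f) =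
      (if j == i then f else 0) + sel _ a b c e j *: (sp_gen q i * p j f).
  by move=> ha hb hc he; apply: (partial_gen_mul calculus pE); apply: forall_Z22.
(* The scalars are the rows of the commutation table of coordinates with one-forms. *)
have hx := comm ix 1 q q 1.
have hxi := comm ixi q^-1 (-1) 1 (- q^-1).
have htheta := comm itheta q^-1 1 (-1) (- q^-1).
have hz := comm iz 1 (- q) (- q) 1.
(* Removes the factors 1 and -1 from the premises, so that they match the rules of the calculus as
   stated there. *)
rewrite !scale1r in hx hxi htheta hz; rewrite !scaleN1r in hxi htheta.
have {}hx := hx (calc_x_dx calculus) (calc_x_dxi calculus)
  (calc_x_dtheta calculus) (calc_x_dz calculus).
have {}hxi := hxi (calc_xi_dx calculus) (calc_xi_dxi calculus)
  (calc_xi_dtheta calculus) (calc_xi_dz calculus).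
have {}htheta := htheta (calc_theta_dx calculus) (calc_theta_dxi calculus)
  (calc_theta_dtheta calculus) (calc_theta_dz calculus).
have {}hz := hz (calc_z_dx calculus) (calc_z_dxi calculus)
  (calc_z_dtheta calculus) (calc_z_dz calculus).
split; split.
(* At a concrete index the delta and [sel] compute: the diagonal rules keep [f], the others lose a
   zero summand by [add0r], and factors 1 or -1 are simplified. *)
- by have := hx ix; rewrite /= scale1r.
- by have := hx ixi; rewrite /= add0r.
- by have := hx itheta; rewrite /= add0r.
- by have := hx iz; rewrite /= add0r scale1r.
- by have := hxi ix; rewrite /= add0r.
- by have := hxi ixi; rewrite /= scaleN1r.
- by have := hxi itheta; rewrite /= add0r scale1r.
- by have := hxi iz; rewrite /= add0r.
- by have := htheta ix; rewrite /= add0r.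
- by have := htheta ixi; rewrite /= add0r scale1r.
- by have := htheta itheta; rewrite /= scaleN1r.
- by have := htheta iz; rewrite /= add0r.
- by have := hz ix; rewrite /= add0r scale1r.
- by have := hz ixi; rewrite /= add0r.
- by have := hz itheta; rewrite /= add0r.
- by have := hz iz; rewrite /= scale1r.
Qed.
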